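(* For every integer $d \geq 3$, the joined graph $(K_2 \cup E_{2d-4}) + (K_{d-1}\cup E_2)$ is generically locally rigid in $\mathbb{R}^d$.
   Context: All graphs are finite, undirected and simple. $K_n$ is the complete graph on $n$ vertices and $E_n$ is the graph on $n$ vertices with no edges. $G\cup H$ denotes the disjoint union of graphs. The graph join $G+H$ has vertex set $V_G\sqcup V_H$ and edge set $E_G\cup E_H\cup\{v_gv_h : v_g\in V_G, v_h\in V_H\}$. A $d$-dimensional framework $(G,p)$ is a graph $G=(V,E)$ with a configuration $p:V\to\mathbb{R}^d$, $v_i\mapsto p_i$, where not all vertices lie on a hyperplane. Frameworks $(G,p)$ and $(G,q)$ are equivalent if $\|p_i-p_j\|=\|q_i-q_j\|$ for all adjacent $v_i,v_j$, and congruent if this holds for all pairs $v_i,v_j$. A framework is generic if the coordinates of its vertices are algebraically independent over $\mathbb{Z}$. A framework $(G,p)$ is locally flexible if there is a parametric (continuous) curve in $\mathbb{R}^{|V|d}$, starting at $p$, of configurations equivalent to $p$ that is not a Euclidean motion (i.e. not all configurations on it are congruent to $p$); otherwise it is locally rigid. A graph is generically locally rigid in $\mathbb{R}^d$ if every generic $d$-dimensional framework of it is locally rigid. *)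

(* Defs.v *)
(* Imported first and without its notations: some of its names and notations
   clash with those of MathComp and MathComp-Analysis. *)
From mathcomp Require Import -(notations) mpoly.
From HB Require Import structures.
From mathcomp Require Import all_boot all_order all_algebra.
From mathcomp Require Import all_classical all_reals all_analysis.

Set Implicit Arguments.
Unset Strict Implicit.
Unset Printing Implicit Defensive.

Import Order.TTheory GRing.Theory Num.Theory.
Import numFieldNormedType.Exports.

Local Open Scope classical_set_scope.
Local Open Scope ring_scope.

Record sgraph := SGraph {
  vertex :> finType;
  edge : rel vertex;
  edge_sym : symmetric edge;
  edge_irrefl : irreflexive edge
}.

Section CompleteEdgeless.
Variable n : nat.

Definition complete_rel : rel 'I_n := fun i j => i != j.

Lemma complete_rel_sym : symmetric complete_rel.
Proof. by move=> i j; rewrite /complete_rel eq_sym. Qed.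

Lemma complete_rel_irrefl : irreflexive complete_rel.
Proof. by move=> i; rewrite /complete_rel eqxx. Qed.

Definition complete_graph := SGraph complete_rel_sym complete_rel_irrefl.

Definition edgeless_rel : rel 'I_n := fun _ _ => false.

Lemma edgeless_rel_sym : symmetric edgeless_rel.
Proof. by []. Qed.

Lemma edgeless_rel_irrefl : irreflexive edgeless_rel.
Proof. by []. Qed.

Definition edgeless_graph := SGraph edgeless_rel_sym edgeless_rel_irrefl.

End CompleteEdgeless.

Section UnionJoin.
Variables G H : sgraph.

(* [cross] decides the adjacency of a vertex of [G] and a vertex of [H]. *)
Definition sum_rel (cross : bool) : rel (G + H)%type := fun u v =>
  match u, v with
  | inl x, inl y => edge x y
  | inr x, inr y => edge x y
  | _, _ => cross
  end.

Lemma sum_rel_sym cross : symmetric (sum_rel cross).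
Proof. by move=> [x|x] [y|y] //=; rewrite edge_sym. Qed.

Lemma sum_rel_irrefl cross : irreflexive (sum_rel cross).
Proof. by move=> [x|x] /=; rewrite edge_irrefl. Qed.

Definition graph_union := SGraph (sum_rel_sym false) (sum_rel_irrefl false).

Definition graph_join := SGraph (sum_rel_sym true) (sum_rel_irrefl true).

End UnionJoin.

(* The norm [`|v|] of MathComp-Analysis on row vectors is the sup norm. *)
Definition euclid_norm (R : realType) (d : nat) (v : 'rV[R]_d) : R :=
  Num.sqrt (\sum_(k < d) v 0 k ^+ 2).

(* Function types carry no canonical topology; [ptws] selects the product
   topology, i.e. the one of R^(|V| d). *)
Definition configuration (R : realType) (d : nat) (G : sgraph) :=
  {ptws (vertex G) -> 'rV[R]_d}.

(* Algebraic independence over Z of the family [x]; [enum_val] numbers [I] by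
   the variables of the polynomial. *)
Definition alg_independent_int (A : comNzRingType) (I : finType) (x : I -> A) :=
  forall P : mpoly #|I| int,
    mmap (fun c : int => c%:~R : A) (fun k => x (enum_val k)) P = 0 ->
    P = 0.

Section Frameworks.
Variables (R : realType) (d : nat) (G : sgraph).
Implicit Types p q : configuration R d G.

Definition lies_on_hyperplane p :=
  exists (a : 'rV[R]_d) (b : R),
    a != 0 /\ forall v, \sum_(k < d) a 0 k * p v 0 k = b.

Definition is_framework p := ~ lies_on_hyperplane p.

Definition equivalent p q :=
  forall u v, edge u v -> euclid_norm (p u - p v) = euclid_norm (q u - q v).

Definition congruent p q :=
  forall u v, euclid_norm (p u - p v) = euclid_norm (q u - q v).

Definition generic p :=
  alg_independent_int (fun vk : vertex G * 'I_d => p vk.1 0 vk.2).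

Definition locally_flexible p :=
  exists gamma : R -> configuration R d G,
    [/\ {within `[0, 1], continuous gamma},
        gamma 0 = p,
        forall t, t \in `[0, 1] -> equivalent p (gamma t) &
        exists2 t, t \in `[0, 1] & ~ congruent p (gamma t)].

Definition locally_rigid p := ~ locally_flexible p.

End Frameworks.

Definition generically_locally_rigid (R : realType) (d : nat) (G : sgraph) :=
  forall p : configuration R d G,
    is_framework p -> generic p -> locally_rigid p.

(* Main.v *)
Require Import Defs.
From mathcomp Require Import -(notations) mpoly.
From mathcomp Require Import all_boot all_order all_algebra.
From mathcomp Require Import all_classical all_reals all_analysis.
From mathcomp Require Import zify ring lra.

(** The proof is an averaging argument in the spirit of Bolker and Roth; it
    replaces derivatives by midpoints and holds for joins GA + GB with
    |GB| = d + 1 in general.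

    Let p and q be equivalent frameworks, x = (p + q) / 2, and let
    s(u, v) = |p_u - p_v|^2 - |q_u - q_v|^2, which vanishes on edges.  If the
    d + 1 points x_k, k in GB, form a simplex, every a in GA has barycentric
    weights lam_a with respect to it.  As a polarisation of squared distances
    in R^d x R^d with the form |.|^2 - |.|^2 shows ([defect_transfer]), the
    vanishing of s between GA and GB forces
      s(a, a') = - sum_(k, l) lam_a(k) lam_a'(l) s(k, l)
    for a, a' in GA.  The values om(k, l) = s(k, l) therefore solve the linear
    system [is_strain]: one equation for each a (the case a = a'), one for each
    edge inside GA, and om = 0 on the edges inside GB.  When this system has
    only the zero solution, s vanishes on GB, hence everywhere, and p and q are
    congruent ([sqdist_determined]).

    That the simplex and the system at x are nondegenerate is the nonvanishing
    of a polynomial with integer coefficients in the coordinates of x, and this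
    polynomial depends only on the distances in x ([join_det], [affine_gram]).
    Hence it vanishes at no framework congruent to a generic p, provided that
    it is not the zero polynomial.  Along a curve of frameworks equivalent to p
    the set of parameters with a framework congruent to p is then open (the
    midpoint of two nearby frameworks of the curve is nondegenerate) and
    closed, so it is all of [0, 1] ([locally_rigid_of_midpoints]).

    Everything reduces to one choice of weights for which the system is
    nonsingular ([join_generically_locally_rigid]).  For the graph at hand it
    has as many unknowns as equations, namely 2d - 1, and weights placing the
    vertices of GA at midpoints of pairs from GB make it triangular
    ([midpoint_weights_independent]). *)

Set Implicit Arguments.
Unset Strict Implicit.
Unset Printing Implicit Defensive.

Import Order.TTheory GRing.Theory Num.Theory.
Import numFieldNormedType.Exports.

Local Open Scope ring_scope.

(** * Linear algebra of finite families *)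

Lemma sum_enum_val (A : nmodType) (K : finType) (h : K -> A) :
  \sum_(i < #|K|) h (enum_val i) = \sum_k h k.
Proof.
rewrite (reindex (@enum_val K K)) //=.
by exists enum_rank => i _; rewrite ?enum_valK ?enum_rankK.
Qed.

Lemma sum_indicator (A : nzRingType) (I : finType) (x : I -> A) i :
  \sum_j x j * (j == i)%:R = x i.
Proof.
rewrite (bigD1 i) //= eqxx mulr1 big1 ?addr0 // => j /negPf ->.
by rewrite mulr0.
Qed.

Section Families.
Variables (I J : finType).

(** Determinants require ordinals as indices; this encoding lets graph vertices
    and edges be used instead. *)
Definition fun_mx (A : Type) (f : I -> J -> A) : 'M[A]_(#|I|, #|J|) :=
  \matrix_(i, j) f (enum_val i) (enum_val j).

End Families.

Lemma row_free_of_ker (F : fieldType) m n (M : 'M[F]_(m, n)) :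
  (forall v : 'rV_m, v *m M = 0 -> v = 0) -> row_free M.
Proof.
move=> kerM; rewrite -kermx_eq0; apply/eqP/row_matrixP => r; rewrite row0.
by apply: kerM; rewrite -row_mul mulmx_ker row0.
Qed.

Section FamilyRank.
Variables (F : fieldType) (I J : finType).
Implicit Types f : I -> J -> F.

Definition left_kernel_trivial f :=
  forall x : I -> F, (forall j, \sum_i x i * f i j = 0) -> forall i, x i = 0.

Lemma row_free_fun_mx f : row_free (fun_mx f) <-> left_kernel_trivial f.
Proof.
split=> [free_f x xf0 i | ker_f].
  have /row_free_inj inj := free_f.
  suff /rowP/(_ (enum_rank i)) : (\row_i x (enum_val i) : 'rV_#|I|) = 0.
    by rewrite !mxE enum_rankK.
  apply: inj; rewrite mul0mx; apply/rowP => j; rewrite !mxE.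
  under eq_bigr => k _ do rewrite !mxE.
  by rewrite (sum_enum_val (fun k => x k * f k (enum_val j))) xf0.
apply: row_free_of_ker => v vf0.
apply/rowP => i; rewrite [RHS]mxE -(enum_valK i).
apply: (ker_f (fun i => v 0 (enum_rank i))) => j.
transitivity ((v *m fun_mx f) 0 (enum_rank j)); last by rewrite vf0 mxE.
rewrite mxE -(sum_enum_val (fun i => v 0 (enum_rank i) * f i j)).
by apply: eq_bigr => k _; rewrite enum_valK mxE enum_rankK.
Qed.

Lemma right_kernel_trivial f : #|I| = #|J| -> left_kernel_trivial f ->
  forall y : J -> F, (forall i, \sum_j f i j * y j = 0) -> forall j, y j = 0.
Proof.
move=> eqIJ /row_free_fun_mx; rewrite -row_leq_rank => le_rank y fy0 j.
have full : row_full (fun_mx f).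
  by rewrite -col_leq_rank (leq_trans _ le_rank) // eqIJ.
suff /colP/(_ (enum_rank j)) : (\col_j y (enum_val j) : 'cV_#|J|) = 0.
  by rewrite !mxE enum_rankK.
apply: (row_full_inj full); rewrite mulmx0; apply/colP => i; rewrite !mxE.
under eq_bigr => k _ do rewrite !mxE.
by rewrite (sum_enum_val (fun k => f (enum_val i) k * y k)) fy0.
Qed.

End FamilyRank.

Definition gram_of (I : Type) (J : finType) (A : pzRingType)
    (f : I -> J -> A) i i' :=
  \sum_j f i j * f i' j.

Section Gram.
Variables (I J : finType).

Lemma fun_mx_gram (F : fieldType) (f : I -> J -> F) :
  fun_mx (gram_of f) = fun_mx f *m (fun_mx f)^T.
Proof.
apply/matrixP => i i'; rewrite !mxE -[LHS]sum_enum_val.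
by apply: eq_bigr => j _; rewrite !mxE.
Qed.

(** Over an ordered field [v *m M *m M^T = 0] makes the sum of squares
    [v *m M *m (v *m M)^T] vanish; hence a polynomial in the entries detects
    the full row rank of a rectangular matrix. *)
Lemma det_gram_neq0 (F : realFieldType) (f : I -> J -> F) :
  \det (fun_mx (gram_of f)) != 0 <-> left_kernel_trivial f.
Proof.
rewrite -row_free_fun_mx fun_mx_gram -unitfE; set M := fun_mx f.
rewrite [X in is_true X <-> _](_ : _ = row_free (M *m M^T)); last first.
  by rewrite row_free_unit unitmxE.
split=> [free_MM | free_M].
  move: free_MM; rewrite -!row_leq_rank => /leq_trans; apply.
  exact: mxrankM_maxl.
apply: row_free_of_ker => v vMM.
apply: (row_free_inj free_M); rewrite mul0mx.
have : (v *m M *m (v *m M)^T) 0 0 = 0.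
  by rewrite trmx_mul -!mulmxA (mulmxA M) (mulmxA v) vMM mul0mx mxE.
rewrite mxE => /eqP; rewrite psumr_eq0; last first.
  by move=> j _; rewrite [_^T _ _]mxE -expr2 sqr_ge0.
move=> /allP vM0; apply/rowP => j; rewrite [RHS]mxE; apply/eqP.
have := vM0 j (mem_index_enum _).
by rewrite [_^T _ _]mxE -expr2 sqrf_eq0.
Qed.

End Gram.

Lemma eq_fun_mx (A : Type) (I J : finType) (f f' : I -> J -> A) :
  f =2 f' -> fun_mx f = fun_mx f'.
Proof. by move=> eq_f; apply/matrixP => i j; rewrite !mxE. Qed.

Lemma map_fun_mx (A B : Type) (h : A -> B) (I J : finType) (f : I -> J -> A) :
  map_mx h (fun_mx f) = fun_mx (fun i j => h (f i j)).
Proof. by apply/matrixP => i j; rewrite !mxE. Qed.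

(** * Barycentric weights from Gram matrices *)

Section Weights.
Variables (U K : finType).

Section Ring.
Variable A : comNzRingType.
Implicit Types g : U + K -> U + K -> A.

Definition base_gram g := fun_mx (fun k l => g (inr k) (inr l)).

(** Cramer's rule without the division: up to the factor
    [\det (base_gram g)], the coordinates of the point [u] in the base points,
    read off from Gram entries alone.  Polynomial in these entries, it can be
    evaluated over any commutative ring and takes equal values at congruent
    frameworks. *)
Definition weight g (u : U) (k : K) : A :=
  \sum_l g (inl u) (inr l) * \adj (base_gram g) (enum_rank l) (enum_rank k).

Lemma weightE g u k : weight g u k =
  ((\row_l g (inl u) (inr (enum_val l))) *m \adj (base_gram g)) 0 (enum_rank k).
Proof.
rewrite [RHS]mxE /weight -[LHS]sum_enum_val.
by apply: eq_bigr => l _; rewrite enum_valK [X in _ = X * _]mxE.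
Qed.

Lemma weight_base_gram g u l :
  \sum_k weight g u k * g (inr k) (inr l)
  = \det (base_gram g) * g (inl u) (inr l).
Proof.
pose v : 'rV_#|K| := \row_l g (inl u) (inr (enum_val l)).
transitivity ((v *m \adj (base_gram g) *m base_gram g) 0 (enum_rank l)).
  rewrite [RHS]mxE -[LHS]sum_enum_val; apply: eq_bigr => k _.
  by rewrite weightE enum_valK [base_gram _ _ _]mxE enum_rankK.
by rewrite -mulmxA mul_adj_mx mul_mx_scalar !mxE enum_rankK.
Qed.

Lemma weight_combination g u (lam : K -> A) :
  (forall l, g (inl u) (inr l) = \sum_k lam k * g (inr k) (inr l)) ->
  forall k, weight g u k = \det (base_gram g) * lam k.
Proof.
move=> g_lam k; rewrite weightE.
have -> : \row_l g (inl u) (inr (enum_val l))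
          = (\row_k lam (enum_val k)) *m base_gram g.
  apply/rowP => l; rewrite !mxE g_lam -[LHS]sum_enum_val.
  by apply: eq_bigr => i _; rewrite !mxE.
by rewrite -mulmxA mul_mx_adj mul_mx_scalar !mxE enum_rankK.
Qed.

End Ring.

Lemma rmorph_det_base_gram (A B : comNzRingType) (phi : {rmorphism A -> B}) g :
  phi (\det (base_gram g)) = \det (base_gram (fun x y => phi (g x y))).
Proof. by rewrite -det_map_mx map_fun_mx. Qed.

Lemma rmorph_weight (A B : comNzRingType) (phi : {rmorphism A -> B}) g u k :
  phi (weight g u k) = weight (fun x y => phi (g x y)) u k.
Proof.
rewrite /weight rmorph_sum; apply: eq_bigr => l _.
rewrite rmorphM; congr (_ * _).
by rewrite /base_gram -(map_fun_mx phi) -map_mx_adj [RHS]mxE.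
Qed.

End Weights.

(** * The linear system of a join *)

Section System.
Variables (GA GB : sgraph).

(** The pairs at which equivalent frameworks agree for sure. *)
Definition known_pair (G : sgraph) (x y : G) := (x == y) || edge x y.

Section Ring.
Variable A : comNzRingType.
Implicit Types (w : GA -> GB -> A) (om : GB -> GB -> A).

Definition bilin w om a a' := \sum_k \sum_l w a k * w a' l * om k l.

(** The conditions met on [GB] by the difference of squared distances of two
    equivalent frameworks, when [w] gives the barycentric weights of [GA] with
    respect to [GB] in their midpoint. *)
Definition is_strain w om :=
  [/\ forall k l, om k l = om l k,
      forall k l, known_pair k l -> om k l = 0 &
      forall a a', known_pair a a' -> bilin w om a a' = 0].

(** Taking all ordered pairs as unknowns avoids choosing representatives of the
    non-edges; symmetry and vanishing at known pairs then count as equations.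
    Equations that belong to a pair that is not known are made void. *)
Definition strain_coef w (kl : GB * GB)
    (c : (GB * GB + GB * GB) + GA * GA) : A :=
  match c with
  | inl (inl c) => (kl == c)%:R - (kl == (c.2, c.1))%:R
  | inl (inr c) => (known_pair c.1 c.2 && (kl == c))%:R
  | inr c => (known_pair c.1 c.2)%:R * (w c.1 kl.1 * w c.2 kl.2)
  end.

Definition independent_weights w :=
  forall om, is_strain w om -> forall k l, om k l = 0.

(** When |GB| = d + 1, this is nonzero at the Gram matrix of a configuration
    exactly when the vertices of [GB] form a simplex and the barycentric weights
    of [GA] with respect to it are independent.  The system is not square as
    given, so its rank is tested by a Gram determinant. *)
Definition join_det (g : GA + GB -> GA + GB -> A) :=
  \det (base_gram g) *
  \det (fun_mx (gram_of (strain_coef (weight g)))).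

End Ring.

(** What makes [join_det] a polynomial: evaluating it on indeterminates and
    then substituting numbers is the same as evaluating it on the numbers. *)
Lemma rmorph_join_det (A B : comNzRingType) (phi : {rmorphism A -> B}) g :
  phi (join_det g) = join_det (fun x y => phi (g x y)).
Proof.
rewrite rmorphM rmorph_det_base_gram -det_map_mx map_fun_mx; congr (_ * \det _).
apply: eq_fun_mx => kl kl'; rewrite /gram_of rmorph_sum.
have phi_coef x c : phi (strain_coef (weight g) x c)
                    = strain_coef (weight (fun x y => phi (g x y))) x c.
  case: c => [[]|] c /=; first by rewrite rmorphB !rmorph_nat.
    by rewrite rmorph_nat.
  by rewrite !rmorphM rmorph_nat !rmorph_weight.
by apply: eq_bigr => c _; rewrite rmorphM !phi_coef.
Qed.

Lemma independent_weightsP (F : fieldType) (w : GA -> GB -> F) :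
  independent_weights w <-> left_kernel_trivial (strain_coef w).
Proof.
have eqn om c : \sum_kl om kl * strain_coef w kl c =
    match c with
    | inl (inl c) => om c - om (c.2, c.1)
    | inl (inr c) => (known_pair c.1 c.2)%:R * om c
    | inr c => (known_pair c.1 c.2)%:R *
               bilin w (fun k l => om (k, l)) c.1 c.2
    end.
  case: c => [[]|] c /=.
  - under eq_bigr => kl _ do rewrite mulrBr.
    by rewrite sumrB !sum_indicator.
  - case: known_pair => /=; first by rewrite sum_indicator mul1r.
    by rewrite mul0r big1 // => kl _; rewrite mulr0.
  - rewrite /bilin pair_bigA /= mulr_sumr; apply: eq_bigr => -[k l] _ /=.
    by ring.
split=> [indep om ker_om [k l] | ker_coef om [om_sym om_known om_bilin] k l].
  apply: (indep (fun k l => om (k, l))); split=> [k' l'|k' l' kl'|a a' aa'].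
  - by have := ker_om (inl (inl (k', l'))); rewrite eqn => /eqP; rewrite subr_eq0 => /eqP.
  - by have := ker_om (inl (inr (k', l'))); rewrite eqn kl' mul1r.
  - by have := ker_om (inr (a, a')); rewrite eqn aa' mul1r.
apply: (ker_coef (fun kl => om kl.1 kl.2) _ (k, l)) => c; rewrite eqn.
case: c => [[]|] [x y] /=; first by rewrite om_sym subrr.
  by case E: known_pair; rewrite ?mul0r // om_known ?mulr0.
by case E: known_pair; rewrite ?mul0r // om_bilin ?mulr0.
Qed.

End System.

(** * Equivalent frameworks and their midpoint *)

Section Coordinates.
Variables (V : Type) (d : nat).

(** Coordinates relative to the vertex [o], with a homogenising 1 in front: a
    linear relation between such coordinates is an affine relation between the
    points, and their products depend only on distances. *)
Definition affine_coord (A : pzRingType) (x : V -> 'rV[A]_d) (o v : V)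
    (c : option 'I_d) : A :=
  if c is Some j then x v 0 j - x o 0 j else 1.

Definition affine_gram (A : pzRingType) (x : V -> 'rV[A]_d) (o : V) :=
  gram_of (affine_coord x o).

Definition sqdist (A : pzRingType) (x : V -> 'rV[A]_d) (u v : V) : A :=
  \sum_j (x u 0 j - x v 0 j) ^+ 2.

Lemma affine_gramE (A : pzRingType) (x : V -> 'rV[A]_d) o u v :
  affine_gram x o u v =
  1 + \sum_j (x u 0 j - x o 0 j) * (x v 0 j - x o 0 j).
Proof.
rewrite /affine_gram /gram_of (bigD1 None) //= mulr1; congr (_ + _).
rewrite (reindex_omap Some id) //=; last by case.
by apply: eq_bigl => j; rewrite eqxx.
Qed.

(** Polarisation; this is why nondegeneracy passes to congruent frameworks. *)
Lemma affine_gram_sqdist (F : numFieldType) (x : V -> 'rV[F]_d) o u v :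
  affine_gram x o u v =
  1 + (sqdist x u o + sqdist x v o - sqdist x u v) / 2.
Proof.
rewrite affine_gramE /sqdist -big_split -sumrB mulr_suml; congr (_ + _).
by apply: eq_bigr => j _ /=; field.
Qed.

End Coordinates.

Section Transfer.
Variables (A : comNzRingType) (V K : finType) (b : K -> V) (d : nat).
Variables (p q : V -> 'rV[A]_d).

Definition defect u v := sqdist p u v - sqdist q u v.

Lemma defect_sym u v : defect u v = defect v u.
Proof.
by rewrite /defect /sqdist -!sumrB; apply: eq_bigr => j _; ring.
Qed.

Lemma defectxx u : defect u u = 0.
Proof.
by rewrite /defect /sqdist -!sumrB big1 // => j _; ring.
Qed.

(** The form N(y, z) = |y|^2 - |z|^2 on pairs has polar form B, and [defect] is
    N of differences of the points X_u = (p u, q u).  Polarisation gives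
      defect u l + defect k u' - defect k l - defect u u'
        = 2 B(X_u - X_k, X_u' - X_l).
    Averaging over k and l turns the right-hand side into B at two vectors of
    the form (y, - y), where it vanishes: the weights reproduce p + q. *)
Lemma defect_transfer (lam lam' : K -> A) (u u' : V) :
  \sum_k lam k = 1 -> \sum_k lam' k = 1 ->
  (forall j, \sum_k lam k * (p (b k) 0 j + q (b k) 0 j) = p u 0 j + q u 0 j) ->
  (forall j, \sum_k lam' k * (p (b k) 0 j + q (b k) 0 j)
             = p u' 0 j + q u' 0 j) ->
  \sum_l lam' l * defect u (b l) + \sum_k lam k * defect (b k) u'
  = defect u u' + \sum_k \sum_l lam k * lam' l * defect (b k) (b l).
Proof.
move=> lam1 lam1' lam_u lam_u'.
have split_coord (h : K -> A) (f : K -> 'I_d -> A) :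
    \sum_k h k * (\sum_j f k j) = \sum_j \sum_k h k * f k j.
  by rewrite exchange_big; apply: eq_bigr => k _; rewrite mulr_sumr.
rewrite /defect /sqdist -!sumrB.
under eq_bigr do rewrite -sumrB; rewrite split_coord.
under [X in _ + X = _]eq_bigr do rewrite -sumrB; rewrite split_coord.
under [X in _ = _ + X]eq_bigr => k _.
  under eq_bigr do rewrite -sumrB.
  rewrite split_coord.
  over.
rewrite [X in _ = _ + X]exchange_big -!big_split; apply: eq_bigr => j _ /=.
(* The identity holds coordinate by coordinate; from here on all quantities
   are scalars, and only the moments of the weights enter. *)
pose P k := p (b k) 0 j; pose Q k := q (b k) 0 j.
pose s := \sum_k lam k * P k; pose s' := \sum_k lam' k * P k.
pose t := \sum_k lam k * Q k; pose t' := \sum_k lam' k * Q k.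
pose S := \sum_k lam k * (P k ^+ 2 - Q k ^+ 2).
pose S' := \sum_k lam' k * (P k ^+ 2 - Q k ^+ 2).
have st : s + t = p u 0 j + q u 0 j.
  by rewrite -lam_u -big_split; apply: eq_bigr => k _; rewrite mulrDr.
have st' : s' + t' = p u' 0 j + q u' 0 j.
  by rewrite -lam_u' -big_split; apply: eq_bigr => k _; rewrite mulrDr.
have E1 y z (h : K -> A) : \sum_k h k = 1 ->
    \sum_k h k * ((y - P k) ^+ 2 - (z - Q k) ^+ 2) =
    y ^+ 2 - z ^+ 2 - 2 * y * (\sum_k h k * P k)
      + 2 * z * (\sum_k h k * Q k) + \sum_k h k * (P k ^+ 2 - Q k ^+ 2).
  move=> h1; have -> : y ^+ 2 - z ^+ 2 = (\sum_k h k) * (y ^+ 2 - z ^+ 2).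
    by rewrite h1 mul1r.
  rewrite mulr_suml !mulr_sumr -sumrB -!big_split.
  by apply: eq_bigr => k _ /=; ring.
rewrite (E1 _ _ _ lam1').
have -> : \sum_k lam k * ((p (b k) 0 j - p u' 0 j) ^+ 2
                        - (q (b k) 0 j - q u' 0 j) ^+ 2) =
    \sum_k lam k * ((p u' 0 j - P k) ^+ 2 - (q u' 0 j - Q k) ^+ 2).
  by apply: eq_bigr => k _; rewrite /P /Q; ring.
rewrite (E1 _ _ _ lam1).
have -> : \sum_k \sum_l lam k * lam' l *
     ((p (b k) 0 j - p (b l) 0 j) ^+ 2 - (q (b k) 0 j - q (b l) 0 j) ^+ 2) =
    S + S' - 2 * s * s' + 2 * t * t'.
  transitivity (\sum_k lam k *
     (P k ^+ 2 - Q k ^+ 2 - 2 * P k * s' + 2 * Q k * t' + S')).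
    apply: eq_bigr => k _; rewrite -(E1 _ _ _ lam1') mulr_sumr.
    by apply: eq_bigr => l _; rewrite mulrA.
  have -> : S + S' = S + (\sum_k lam k) * S' by rewrite lam1 mul1r.
  rewrite /S /s /t !(mulr_suml, mulr_sumr) -sumrN -!big_split.
  by apply: eq_bigr => k _ /=; ring.
rewrite -/s -/s' -/t -/t' -/S -/S'.
(* The difference of the two sides is
   2 (p u - s) (p u' - s') - 2 (q u - t) (q u' - t'), and q u - t = s - p u. *)
have -> : t = p u 0 j + q u 0 j - s by rewrite -st; ring.
have -> : t' = p u' 0 j + q u' 0 j - s' by rewrite -st'; ring.
by ring.
Qed.

End Transfer.

Section Join.
Variables (F : realFieldType) (d : nat) (GA GB : sgraph).
Local Notation V := (GA + GB)%type.

Definition barycentric (x : V -> 'rV[F]_d) (lam : GA -> GB -> F) :=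
  forall a, \sum_k lam a k = 1 /\
    forall j, \sum_k lam a k * x (inr k) 0 j = x (inl a) 0 j.

Lemma barycentric_affine_coord x o lam : barycentric x lam -> forall a c,
  \sum_k lam a k * affine_coord x o (inr k) c = affine_coord x o (inl a) c.
Proof.
move=> bary a; have [lam1 lam_x] := bary a; case=> [j|] /=; last first.
  by rewrite -[RHS]lam1; apply: eq_bigr => k _; rewrite mulr1.
under eq_bigr do rewrite mulrBr.
by rewrite sumrB lam_x -mulr_suml lam1 mul1r.
Qed.

Lemma join_det_neq0 x o lam : barycentric x lam ->
  left_kernel_trivial (fun k => affine_coord x o (inr k)) ->
  independent_weights lam -> join_det (affine_gram x o) != 0.
Proof.
move=> bary spanning indep.
have D0 : \det (base_gram (affine_gram x o)) != 0 by apply/det_gram_neq0.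
rewrite mulf_neq0 //; apply/det_gram_neq0/independent_weightsP => om om_strain.
apply: indep; case: om_strain => om_sym om_known om_bilin; split=> // a a' aa'.
have wE u k : weight (affine_gram x o) u k =
    \det (base_gram (affine_gram x o)) * lam u k.
  apply: weight_combination => l; rewrite /affine_gram /gram_of.
  under [RHS]eq_bigr do rewrite mulr_sumr; rewrite exchange_big.
  apply: eq_bigr => c _; rewrite -(barycentric_affine_coord o bary) mulr_suml.
  by apply: eq_bigr => k' _; rewrite mulrA.
move: D0 wE; set D := \det _ => D0 wE.
apply: (mulfI D0); apply: (mulfI D0); rewrite !mulr0 -[RHS](om_bilin _ _ aa').
rewrite /bilin !mulr_sumr; apply: eq_bigr => k _; rewrite !mulr_sumr.
by apply: eq_bigr => l _; rewrite !wE; ring.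
Qed.

(** As [GB] has exactly d + 1 vertices, the square matrix of their affine
    coordinates is invertible; so the weights, which are right after pairing
    with the base points, are right in every coordinate. *)
Lemma join_det_weights x o : #|GB| = d.+1 ->
  join_det (affine_gram x o) != 0 ->
  exists2 lam, barycentric x lam & independent_weights lam.
Proof.
move=> cardB; rewrite mulf_eq0 negb_or => /andP[D0 T0].
pose f k := affine_coord x o (inr k).
have ker_f : left_kernel_trivial f by apply/det_gram_neq0.
set w := weight (affine_gram x o).
move: T0 => /det_gram_neq0/independent_weightsP indep.
set D := \det _ in D0.
have wE a c : \sum_k w a k * f k c = D * affine_coord x o (inl a) c.
  apply/eqP; rewrite -subr_eq0; apply/eqP.
  have card_eq : #|GB| = #|{: option 'I_d}| by rewrite card_option card_ord.
  apply: (right_kernel_trivial card_eq ker_f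
    (y := fun c => \sum_k w a k * f k c - D * affine_coord x o (inl a) c)) => l.
  under eq_bigr do rewrite mulrBr; rewrite sumrB; apply/eqP; rewrite subr_eq0.
  apply/eqP; transitivity (D * affine_gram x o (inl a) (inr l)).
    rewrite -weight_base_gram -/w.
    under eq_bigr do rewrite mulr_sumr; rewrite exchange_big.
    apply: eq_bigr => k _; rewrite mulr_sumr.
    by apply: eq_bigr => c' _; rewrite /f; ring.
  rewrite mulr_sumr; apply: eq_bigr => c' _; rewrite /f; ring.
have sum_w a : \sum_k w a k = D.
  by have := wE a None; rewrite mulr1 => <-; apply: eq_bigr => k _; rewrite mulr1.
exists (fun a k => w a k / D).
  move=> a; split=> [|j]; first by rewrite -mulr_suml sum_w divff.
  apply: (mulfI D0); apply: (addIr (- (D * x o 0 j))).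
  rewrite -[RHS]mulrBr -[RHS](wE a (Some j)).
  have -> : D * (\sum_k w a k / D * x (inr k) 0 j)
            = \sum_k w a k * x (inr k) 0 j.
    by rewrite mulr_sumr; apply: eq_bigr => k _; field.
  have -> : D * x o 0 j = \sum_k w a k * x o 0 j by rewrite -mulr_suml sum_w.
  by rewrite -sumrB; apply: eq_bigr => k _; rewrite /f /=; ring.
move=> om [om_sym om_known om_bilin] k l; apply: indep; split=> // a a' aa'.
have := om_bilin a a' aa' => /(congr1 (fun y => D * (D * y))).
rewrite !mulr0 => <-; rewrite /bilin !mulr_sumr; apply: eq_bigr => k' _.
by rewrite !mulr_sumr; apply: eq_bigr => l' _; rewrite -/w; field.
Qed.

(** The rigidity statement proper, purely algebraic: two frameworks that agree
    on the edges of the join and have a nondegenerate midpoint agree on all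
    pairs. *)
Lemma sqdist_determined (p q x : V -> 'rV[F]_d) lam :
  (forall u j, p u 0 j + q u 0 j = 2 * x u 0 j) ->
  barycentric x lam -> independent_weights lam ->
  (forall u v : graph_join GA GB, edge u v -> sqdist p u v = sqdist q u v) ->
  forall u v, sqdist p u v = sqdist q u v.
Proof.
move=> mid bary indep eq_edge.
have edge0 (u v : graph_join GA GB) : edge u v -> defect p q u v = 0.
  by move=> /eq_edge eq_uv; rewrite /defect eq_uv subrr.
have cross0 a k : defect p q (inl a) (inr k) = 0 by apply: edge0.
have mid_bary a j : \sum_k lam a k * (p (inr k) 0 j + q (inr k) 0 j)
                    = p (inl a) 0 j + q (inl a) 0 j.
  rewrite mid -(proj2 (bary a)) mulr_sumr; apply: eq_bigr => k _.
  by rewrite mid; ring.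
have transfer a a' : defect p q (inl a) (inl a') =
    - bilin lam (fun k l => defect p q (inr k) (inr l)) a a'.
  have := defect_transfer (proj1 (bary a)) (proj1 (bary a'))
    (mid_bary a) (mid_bary a').
  rewrite big1 => [|l _]; last by rewrite cross0 mulr0.
  rewrite big1 => [|l _]; last by rewrite defect_sym cross0 mulr0.
  by rewrite addr0 => /esym/eqP; rewrite addr_eq0 => /eqP.
have base0 k l : defect p q (inr k) (inr l) = 0.
  apply: (indep (fun k l => defect p q (inr k) (inr l))) => {k l}.
  split=> [k l|k l|a a'].
  - exact: defect_sym.
  - case/orP=> [/eqP->|kl]; first exact: defectxx.
    exact: (edge0 (inr k) (inr l)).
  - move=> aa'; apply/eqP; rewrite -oppr_eq0 -transfer; apply/eqP.
    case/orP: aa' => [/eqP->|aa']; first exact: defectxx.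
    exact: (edge0 (inl a) (inl a')).
suff all0 u v : defect p q u v = 0.
  by move=> u v; apply/eqP; rewrite -subr_eq0; apply/eqP/all0.
case: u v => [a|k] [a'|l] //; last by rewrite defect_sym.
rewrite transfer /bilin big1 ?oppr0 // => k _.
by rewrite big1 // => l _; rewrite base0 mulr0.
Qed.

End Join.

(** * Continuity and congruence along a curve *)

Section Configurations.
Local Open Scope classical_set_scope.
Variables (R : realType) (d : nat) (G : sgraph).
Let N := #|((vertex G * 'I_d)%type : finType)|.
Implicit Types p q x : configuration R d G.

Definition eval_conf x : mpoly N int -> R :=
  mmap (fun c : int => c%:~R : R)
    (fun k => let vk : vertex G * 'I_d := enum_val k in x vk.1 0 vk.2).

Definition midpoint p q : configuration R d G := fun v => 2^-1 *: (p v + q v).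

Lemma midpointxx p : midpoint p p = p.
Proof.
by apply/funext => v; apply/rowP => j; rewrite !mxE; field.
Qed.

Lemma eq_euclid_norm p q u v :
  euclid_norm (p u - p v) = euclid_norm (q u - q v) <->
  sqdist p u v = sqdist q u v.
Proof.
have normE x : euclid_norm (x u - x v) = Num.sqrt (sqdist x u v).
  by congr Num.sqrt; apply: eq_bigr => j _; rewrite !mxE.
have sqdist_ge0 x : 0 <= sqdist x u v by apply: sumr_ge0 => j _; exact: sqr_ge0.
rewrite !normE; split=> [/eqP|->//].
by rewrite eqr_sqrt ?sqdist_ge0 // => /eqP.
Qed.

Lemma congruentP p q : congruent p q <-> forall u v, sqdist p u v = sqdist q u v.
Proof. by split=> pq u v; apply/eq_euclid_norm; exact: pq. Qed.

Section Curves.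
Variables (T : topologicalType) (gamma : T -> configuration R d G).
Hypothesis cont_gamma : forall v j, continuous (fun t => gamma t v 0 j).

Lemma eval_curve_continuous P : continuous (fun t => eval_conf (gamma t) P).
Proof.
apply: continuous_big => [|m _]; first exact: add_continuous.
move=> t; apply: (@continuousM _ _ (fun=> (mcoeff m P)%:~R)); first exact: cvg_cst.
apply: continuous_big => [|k _]; first exact: mul_continuous.
move=> s; apply: (@continuous_comp _ _ _ _ (fun y : R => y ^+ m k)).
  exact: cont_gamma.
exact: exprn_continuous.
Qed.

Lemma sqdist_curve_continuous u v : continuous (fun t => sqdist (gamma t) u v).
Proof.
apply: continuous_big => [|j _]; first exact: add_continuous.
move=> s; apply: (@continuous_comp _ _ _
  (fun t => gamma t u 0 j - gamma t v 0 j) (fun y : R => y ^+ 2)).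
  by apply: continuousB; exact: cont_gamma.
exact: exprn_continuous.
Qed.

Lemma midpoint_curve_continuous p v j :
  continuous (fun t => midpoint p (gamma t) v 0 j).
Proof.
have -> : (fun t => midpoint p (gamma t) v 0 j) =
          (fun t => 2^-1 * (p v 0 j + gamma t v 0 j)).
  by apply/funext => t; rewrite !mxE.
move=> t; apply: (@continuousM R T (fun=> 2^-1)
  (fun t => p v 0 j + gamma t v 0 j)); first exact: cvg_cst.
apply: (@continuousD _ _ _ (fun=> p v 0 j)); first exact: cvg_cst.
exact: cont_gamma.
Qed.

End Curves.

Lemma coord_curve_continuous (T : topologicalType)
    (gamma : T -> configuration R d G) v j :
  continuous gamma -> continuous (fun t => gamma t v 0 j).
Proof.
move=> cont_gamma t; apply: (@continuous_comp _ _ _ (fun t => gamma t v)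
  (fun M : 'rV[R]_d => M 0 j)); last exact: coord_continuous.
apply: (@continuous_comp _ _ _ gamma (fun x => x v)); first exact: cont_gamma.
exact: (@proj_continuous _ (fun=> 'rV[R]_d) v).
Qed.

(** Local rigidity without derivatives.  If [P] is nonzero on the congruence
    class of [p], then near a parameter [t] with [gamma t] congruent to [p] it
    is nonzero at the midpoints of [gamma t] and [gamma s], by continuity; so
    the parameters with a framework congruent to [p] form a clopen subset of
    the unit interval. *)
Lemma locally_rigid_of_midpoints p (P : mpoly N int) :
  (forall q, congruent p q -> eval_conf q P != 0) ->
  (forall q q', eval_conf (midpoint q q') P != 0 ->
    equivalent q q' -> congruent q q') ->
  locally_rigid p.
Proof.
move=> P_cong rigid [gamma [cont_gamma gamma0 equiv_gamma [t1 t1I ncong]]].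
pose I : set R := `[0, 1].
pose g : subspace I -> configuration R d G := gamma.
have cont_g v j : continuous (fun t => g t v 0 j).
  exact: coord_curve_continuous.
pose S : set (subspace I) := [set t | I t /\ congruent p (gamma t)].
have S0 : S 0.
  split; first by rewrite /I /= in_itv /= lexx ler01.
  by rewrite gamma0.
suff SI : S = I.
  by apply: ncong; have [] : S t1 by rewrite SI.
have /clopen_connectedP conn : connected I by exact: segment_connected.
apply: conn; [split | by move=> t [] | by exists 0].
  rewrite openE => t [It pt]; rewrite /interior.
  have cont_mid : continuous (fun s => eval_conf (midpoint (gamma t) (g s)) P).
    by apply: eval_curve_continuous => v j; exact: midpoint_curve_continuous.
  have near_mid : \forall s \near (t : subspace I),
      eval_conf (midpoint (gamma t) (gamma s)) P != 0.
    have eval_t : eval_conf (midpoint (gamma t) (g t)) P != 0.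
      by rewrite midpointxx; exact: P_cong.
    apply: (cont_mid t [set y | y != 0]).
    by apply: open_nbhs_nbhs; split; first exact: open_neq.
  have near_I : \forall s \near (t : subspace I), I s.
    by apply: open_nbhs_nbhs; split => //; exact: open_subspaceT.
  near=> s; split; first by near: s.
  move=> u v; rewrite pt; apply: rigid; first by near: s.
  move=> u' v' uv.
  have Is : I s by near: s.
  by rewrite -(equiv_gamma t It _ _ uv) -(equiv_gamma s Is _ _ uv).
have -> : S = I `&` \bigcap_(uv in [set: G * G])
    ((fun t => sqdist (g t) uv.1 uv.2) @^-1` [set y | y = sqdist p uv.1 uv.2]).
  apply/seteqP; split=> t [It pt]; split=> //.
    by move=> [u v] _ /=; have /congruentP <- := pt.
  by apply/congruentP => u v; exact/esym/(pt (u, v)).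
apply: closedI; first exact: closed_subspaceT.
apply: closed_bigI => -[u v] _; apply: preimage_closed.
  by move=> t _; exact: (sqdist_curve_continuous cont_g).
exact: closed_eq.
Unshelve. all: by end_near. Qed.

End Configurations.

(** * Genericity *)

Section GenericVanishing.
Variables (R : realType) (d : nat) (GA GB : sgraph).
Let G := graph_join GA GB.
Let N := #|((vertex G * 'I_d)%type : finType)|.

Lemma join_det_polynomial (o : G) : exists P, forall x : configuration R d G,
  eval_conf x P = join_det (GA := GA) (GB := GB) (affine_gram x o).
Proof.
pose X (v : G) : 'rV[mpoly N int]_d :=
  \row_j mpolyX int (mnm1 (enum_rank ((v, j) : vertex G * 'I_d))).
exists (join_det (GA := GA) (GB := GB) (affine_gram X o)) => x.
pose h (k : 'I_N) := let vk : vertex G * 'I_d := enum_val k in x vk.1 0 vk.2.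
pose phi := [the {rmorphism mpoly N int -> R} of mmap intr h].
have phiX v j : phi (X v 0 j) = x v 0 j.
  by rewrite mxE /= mmapX mmap1U /h enum_rankK.
rewrite /eval_conf -/h (rmorph_join_det phi); congr join_det.
apply/funext => u; apply/funext => v; rewrite !affine_gramE.
rewrite rmorphD rmorph1 rmorph_sum; congr (_ + _); apply: eq_bigr => j _.
by rewrite rmorphM !rmorphB !phiX.
Qed.

End GenericVanishing.

Section JoinRigidity.
Variables (R : realType) (d : nat) (GA GB : sgraph).

(** When |GB| = d + 1, the standard simplex on [GB] with its last vertex at the
    origin, and the vertices of [GA] where the weights [lam] put them. *)
Definition simplex_conf (lam : GA -> GB -> R) :
    configuration R d (graph_join GA GB) :=
  let vertex_of k : 'rV[R]_d := \row_j (val j == enum_rank k)%:R in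
  fun v => match v with
           | inl a => \sum_k lam a k *: vertex_of k
           | inr k => vertex_of k
           end.

Lemma simplex_conf_barycentric lam :
  (forall a, \sum_k lam a k = 1) -> barycentric (simplex_conf lam) lam.
Proof.
move=> lam1 a; split=> // j.
by rewrite summxE; apply: eq_bigr => k _; rewrite !mxE.
Qed.

Lemma simplex_conf_affinely_independent lam o : #|GB| = d.+1 ->
  left_kernel_trivial (fun k => affine_coord (simplex_conf lam) o (inr k)).
Proof.
move=> cardB x ker_x.
have sum_x : \sum_k x k = 0.
  by rewrite -[RHS](ker_x None); apply: eq_bigr => k _; rewrite mulr1.
have x0 k : (enum_rank k < d)%N -> x k = 0.
  move=> lt_kd; have := ker_x (Some (Ordinal lt_kd)).
  under eq_bigr do rewrite mulrBr.
  rewrite sumrB -mulr_suml sum_x mul0r subr0 => <-.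
  rewrite (bigD1 k) //= mxE eqxx mulr1 big1 ?addr0 // => l neq_lk.
  rewrite mxE /= (_ : _ == _ = false) ?mulr0 //.
  by apply/negbTE; rewrite (inj_eq val_inj) (inj_eq enum_rank_inj) eq_sym.
move=> k; have [/x0//|le_dk] := ltnP (enum_rank k) d.
rewrite -sum_x (bigD1 k) //= big1 ?addr0 // => l neq_lk; apply: x0.
have : (enum_rank l < d.+1)%N by rewrite -[X in (_ < X)%N]cardB ltn_ord.
rewrite ltnS leq_eqVlt => /orP[/eqP l_d|//]; case/negP: neq_lk.
apply/eqP/enum_rank_inj/val_inj; rewrite /= l_d; apply/eqP.
have : (enum_rank k < d.+1)%N by rewrite -[X in (_ < X)%N]cardB ltn_ord.
by rewrite ltnS eqn_leq le_dk.
Qed.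

(** One nondegenerate choice of weights suffices, as it witnesses that the
    polynomial given by [join_det] is not zero. *)
Theorem join_generically_locally_rigid (lam : GA -> GB -> R) :
  #|GB| = d.+1 -> (forall a, \sum_k lam a k = 1) -> independent_weights lam ->
  generically_locally_rigid R d (graph_join GA GB).
Proof.
move=> cardB lam1 indep p _ generic_p.
have /card_gt0P [b _] : (0 < #|GB|)%N by rewrite cardB.
pose o : graph_join GA GB := inr b.
have [P PE] := join_det_polynomial R d o.
have P_neq0 : P <> 0.
  have /eqP := join_det_neq0 (o := o) (simplex_conf_barycentric lam1)
    (simplex_conf_affinely_independent (lam := lam) (o := o) cardB) indep.
  by rewrite -PE => + P0; rewrite P0 /eval_conf mmap0.
apply: (locally_rigid_of_midpoints (P := P)) => [q|q q' mid_neq0 eq_qq'].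
  move=> /congruentP pq; rewrite PE.
  have <- : affine_gram p o = affine_gram q o.
    by apply/funext => u; apply/funext => v; rewrite !affine_gram_sqdist !pq.
  by rewrite -PE; apply/eqP => /generic_p.
move: mid_neq0; rewrite PE => /(join_det_weights cardB) [mu bary_mu indep_mu].
apply/congruentP; apply: (sqdist_determined _ bary_mu indep_mu).
  by move=> u j; rewrite !mxE; field.
by move=> u v uv; apply/eq_euclid_norm/eq_qq'.
Qed.

End JoinRigidity.

(** * Independent weights from midpoints *)

Section HalfWeights.
Variables (F : numFieldType) (K : finType).

Definition half_weight (k l m : K) : F := ((m == k)%:R + (m == l)%:R) / 2.

Lemma sum_half_weight k l (f : K -> F) :
  \sum_m half_weight k l m * f m = (f k + f l) / 2.
Proof.
have -> : f k + f l = \sum_m f m * (m == k)%:R + \sum_m f m * (m == l)%:R.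
  by rewrite !sum_indicator.
rewrite -big_split mulr_suml; apply: eq_bigr => m _ /=.
by rewrite /half_weight; ring.
Qed.

Lemma half_weight1 k l : \sum_m half_weight k l m = 1.
Proof.
have := sum_half_weight k l (fun=> 1).
by under eq_bigr do rewrite mulr1; move=> ->; field.
Qed.

End HalfWeights.

Section MidpointWeights.
Variables (R : realType) (d : nat).
Hypothesis hd : (3 <= d)%N.

Let GA := graph_union (complete_graph 2) (edgeless_graph (2 * d - 4)).
Let GB := graph_union (complete_graph (d - 1)) (edgeless_graph 2).

Lemma last_lt : (d - 2 < d - 1)%N. Proof. lia. Qed.
Lemma half_lt (c : 'I_(2 * d - 4)) : (c./2 < d - 1)%N.
Proof. by have := ltn_ord c; lia. Qed.

Definition midpoint_weights (a : GA) : GB -> R :=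
  let e (b : bool) : GB := inr (if b then ord_max else ord0) in
  match a with
  | inl i => half_weight R (e false)
      (if i == ord0 then e true else inl (Ordinal last_lt))
  | inr c => half_weight R (inl (Ordinal (half_lt c))) (e (odd c))
  end.

(** Write e and e' for the two isolated vertices of the second factor, z for the
    last vertex of its complete part.  The weights put a vertex of the first
    factor at the midpoint of the following pairs, so that its own equation
    kills the corresponding unknown: (e, e') and (e, z) for the two adjacent
    vertices, and all pairs (i, e), (i, e') with i <> z for the other 2d - 4
    vertices, numbered by 2i and 2i + 1.  The only unknown left is (e', z); it
    is the only one remaining in the equation of the edge between the two
    adjacent vertices. *)
Lemma midpoint_weights_independent : independent_weights midpoint_weights.
Proof.
move=> om [om_sym om_known om_bilin].
pose e (b : bool) : GB := inr (if b then ord_max else ord0).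
have omxx k : om k k = 0 by rewrite om_known // /known_pair eqxx.
have bilinE a a' k l k' l' : midpoint_weights a = half_weight R k l ->
    midpoint_weights a' = half_weight R k' l' -> known_pair a a' ->
    om k k' + om k l' + om l k' + om l l' = 0.
  move=> wa wa' aa'; have := om_bilin _ _ aa'; rewrite /bilin wa wa'.
  under eq_bigr => m _.
    under eq_bigr do rewrite -mulrA.
    rewrite -mulr_sumr sum_half_weight.
    over.
  by rewrite sum_half_weight => H; lra.
have mid0 a k l : midpoint_weights a = half_weight R k l -> om k l = 0.
  move=> wa; have := bilinE _ _ _ _ _ _ wa wa; rewrite /known_pair eqxx !omxx.
  by rewrite (om_sym l k) => /(_ isT) ?; lra.
have e01 : om (e false) (e true) = 0 by apply: (mid0 (inl ord0)).
pose z : GB := inl (Ordinal last_lt).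
have e0z : om (e false) z = 0 by apply: (mid0 (inl ord_max)).
have e1z : om (e true) z = 0.
  have := bilinE (inl ord0) (inl ord_max) (e false) (e true) (e false) z.
  move=> /(_ erefl erefl erefl); rewrite omxx (om_sym (e true)) e01 e0z.
  by rewrite !add0r.
have inlr (i : 'I_(d - 1)) b : om (inl i) (e b) = 0.
  have [i_last | i_lt] := eqVneq (nat_of_ord i) (d - 2)%N.
    have -> : inl i = z by congr inl; apply: val_inj.
    by rewrite om_sym; case: b.
  have lt_c : (b + i.*2 < 2 * d - 4)%N by have := ltn_ord i; lia.
  apply: (mid0 (inr (Ordinal lt_c))) => /=.
  congr half_weight; last by rewrite oddD odd_double oddb addbF.
  by congr inl; apply: val_inj; rewrite /= half_bit_double.
have inr_e (s : 'I_2) : exists b, inr s = e b.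
  exists (s == ord_max); congr inr; case: eqVneq => // s1.
  by apply: val_inj; case: s s1 => -[|[|]].
case=> [i|s] [j|t].
- have [->|ij] := eqVneq i j; first exact: omxx.
  by apply: om_known; rewrite /known_pair /=; apply/orP; right.
- by have [b ->] := inr_e t.
- by have [b ->] := inr_e s; rewrite om_sym.
- have [[] ->] := inr_e s; have [[] ->] := inr_e t; rewrite ?omxx //.
  by rewrite om_sym.
Qed.

End MidpointWeights.

Theorem lemma7p3 (R : realType) (d : nat) (hd : (3 <= d)%N) :
  generically_locally_rigid R d
    (graph_join
       (graph_union (complete_graph 2) (edgeless_graph (2 * d - 4)))
       (graph_union (complete_graph (d - 1)) (edgeless_graph 2))).
Proof.
apply: (join_generically_locally_rigid (lam := midpoint_weights R hd)).
- by rewrite /= card_sum !card_ord; lia.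
- by case=> [i|c]; exact: half_weight1.
- exact: midpoint_weights_independent.
Qed.
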